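(* Let $t,f,d$ be positive integers with $\lfloor t/f\rfloor\ge 4$ and $0<d<f$, and write $t=fk+r$ with integers $k\ge 4$ and $0<r<f$. Divide the $t$ coins into $3f$ groups $A_1,\dots,A_f$, $B_1,\dots,B_f$, $C_1,\dots,C_f$ with sizes $$|A_i|=k-2,\quad |B_i|=1,\quad |C_i|=2\qquad (1\le i\le r),$$ $$|A_i|=k-3,\quad |B_i|=2,\quad |C_i|=1\qquad (r+1\le i\le f),$$ where the $f$ fake coins are placed either one in each $A_i$, or one in each $B_i$, or one in each $C_i$ ($i=1,\dots,f$). In $f-1$ weighings the lawyer shows that the sets $A_i\cup B_i$ ($1\le i\le f$), each of $k-1$ coins, all balance one another, and in $f-1$ more weighings she shows that the sets $B_i\cup C_i$ ($1\le i\le f$), each of $3$ coins, all balance one another. Then this is a discreet strategy for the parameters $(t,f,d)$.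
   Context: There are $t$ distinguishable coins, identified with a set $T$ with $|T|=t$. All real coins weigh the same, all fake coins weigh the same, and a fake coin is lighter than a real one. Exactly $f$ coins are fake; the lawyer knows the true set $F\subset T$ of fake coins, $|F|=f$. The judge only knows in advance that the number of fake coins is either $f$ or $d$. A weighing places $n\ge 1$ coins on the left pan and $n$ other coins on the right pan of a balance scale; its outcome is one of ''balanced'', ''left pan lighter'', ''right pan lighter'' (the pan with more fake coins is lighter; the pans balance if they contain equally many fake coins). For a finite sequence of weighings performed with true fake set $F$, a set $S\subseteq T$ is consistent if, were $S$ the set of fake coins, every weighing would have the same outcome as it has for $F$. A strategy for $(t,f,d)$ is a choice of $F$ with $|F|=f$ and a finite sequence of weighings that proves to the judge that there are exactly $f$ fake coins, i.e. no set $S$ with $|S|=d$ is consistent. It is discreet if no information about any particular coin is revealed: for every coin $c\in T$ there is a consistent set $S$ with $|S|=f$ and $c\in S$, and also a consistent set $S'$ with $|S'|=f$ and $c\notin S'$. Showing in $f-1$ weighings that $f$ sets of equal size balance one another means, e.g., comparing the first set with each of the other $f-1$ sets. *)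

(* Defs.v *)
From mathcomp Require Import all_boot.

Set Implicit Arguments.
Unset Strict Implicit.
Unset Printing Implicit Defensive.

Section Weighings.

Variable T : finType.
Implicit Types (S F L R : {set T}).

Inductive outcome := Balanced | LeftLighter | RightLighter.

(* The coins on the left pan and the coins on the right pan. *)
Definition weighing : Type := ({set T} * {set T})%type.

Definition valid_weighing (w : weighing) : Prop :=
  [/\ 0 < #|w.1|, #|w.1| = #|w.2| & [disjoint w.1 & w.2]].

(* Fake coins are lighter, and the pans of a valid weighing carry equally many
   coins, so the lighter pan is the one with more fake coins. *)
Definition weigh (S : {set T}) (w : weighing) : outcome :=
  if #|S :&: w.1| == #|S :&: w.2| then Balanced
  else if #|S :&: w.2| < #|S :&: w.1| then LeftLighter
  else RightLighter.

Definition consistent (F : {set T}) (ws : seq weighing) (S : {set T}) : Prop :=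
  forall w, w \in ws -> weigh S w = weigh F w.

(* The total number t of coins is #|T|. *)
Definition is_strategy (f d : nat) (F : {set T}) (ws : seq weighing) : Prop :=
  [/\ #|F| = f,
      forall w, w \in ws -> valid_weighing w
    & ~ exists S, #|S| = d /\ consistent F ws S].

Definition is_discreet (f : nat) (F : {set T}) (ws : seq weighing) : Prop :=
  forall c : T,
    (exists S, [/\ #|S| = f, consistent F ws S & c \in S]) /\
    (exists S, [/\ #|S| = f, consistent F ws S & c \notin S]).

(* What the judge learns: whichever set consistent with the outcomes is the
   set of fake coins, the sets X i all balance one another. *)
Definition shows_balance (I : finType) (F : {set T}) (ws : seq weighing)
    (X : I -> {set T}) : Prop :=
  forall S, consistent F ws S -> forall i j, weigh S (X i, X j) = Balanced.

Definition comparisons (I : finType) (X : I -> {set T}) (p : seq (I * I)) :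
    seq weighing :=
  [seq (X e.1, X e.2) | e <- p].

Definition divided_into (I : finType) (G : I -> {set T}) : Prop :=
  \bigcup_i G i = [set: T] /\ forall i j, i != j -> [disjoint G i & G j].

Definition groups (I : finType) (A B C : I -> {set T}) (x : I + I + I) :
    {set T} :=
  match x with
  | inl (inl i) => A i
  | inl (inr i) => B i
  | inr i => C i
  end.

Definition one_in_each (I : finType) (F : {set T}) (G : I -> {set T}) : Prop :=
  forall i, #|F :&: G i| = 1.

End Weighings.

(* A scheme of n - 1 pairwise comparisons of n sets, the pair (i, j) meaning
   that set i goes on the left pan and set j on the right pan. It can establish
   that all n sets balance because the compared pairs form a connected graph;
   comparing the first set with each of the others is the basic example
   (star_comparison_scheme). *)
Definition comparison_scheme (n : nat) (p : seq ('I_n * 'I_n)) : Prop :=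
  [/\ size p = n - 1,
      forall e, e \in p -> e.1 != e.2
    & forall i j, connect [rel x y | ((x, y) \in p) || ((y, x) \in p)] i j].

Lemma star_comparison_scheme (n : nat) :
  comparison_scheme [seq (ord0 : 'I_n.+1, lift ord0 i) | i <- enum 'I_n].
Proof.
split.
- by rewrite size_map size_enum_ord subn1.
- by move=> e /mapP[i _ ->]; rewrite neq_lift.
have sym: forall i, ((ord0, lift ord0 i) : 'I_n.+1 * 'I_n.+1)
    \in [seq (ord0 : 'I_n.+1, lift ord0 i) | i <- enum 'I_n].
  by move=> i; apply/mapP; exists i; rewrite ?mem_enum.
move=> i j; apply: (@connect_trans _ _ ord0).
- by case: (unliftP ord0 i) => [i' ->|->] //; apply: connect1; rewrite /= sym orbT.
- by case: (unliftP ord0 j) => [j' ->|->] //; apply: connect1; rewrite /= sym.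
Qed.

(* Main.v *)
Require Import Defs.
From mathcomp Require Import all_boot.

Set Implicit Arguments.
Unset Strict Implicit.
Unset Printing Implicit Defensive.

(** Comparisons along a connected graph force, for every consistent set [S],
    the number of coins of [S] in [A i :|: B i] to be the same for all [i], and
    likewise for [B i :|: C i] ([comparisons_balance]); conversely a set that
    meets all [A i :|: B i] equally and all [B i :|: C i] equally is consistent
    ([consistent_comparisons]).

    A number of fake coins strictly between [0] and [f] is impossible: a
    consistent nonempty [S] contains a coin, which lies in some [A i :|: B i] or
    in some [B i :|: C i].  By balance, [S] then meets all [f] sets of that
    kind; they are pairwise disjoint, so [S] has at least [f] elements
    ([leq_card_uniform]).  As [0 < d < f], no consistent set has [d] elements.

    Discretion: the three placements of the fake coins look alike to the judge.
    A set of [f] coins with one coin in each [A i] is a transversal of the [A i]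
    and has no coin elsewhere, so it meets each [A i :|: B i] once and no
    [B i :|: C i]; the placements in the [B i] and in the [C i] are equally
    uniform ([placement_uniform]).  Hence all transversals of the [A i], of
    the [B i] and of the [C i] are consistent.  All groups are nonempty because
    [k >= 4], so each coin belongs to some transversal of its own family and is
    avoided by every transversal of another family. *)

(** * Weighings *)

Lemma weigh_balancedP (T : finType) (S L R : {set T}) :
  weigh S (L, R) = Balanced <-> #|S :&: L| = #|S :&: R|.
Proof.
rewrite /weigh /=; split=> [|->]; last by rewrite eqxx.
by case: eqP => // _; case: ifP.
Qed.

Lemma consistent_cat (T : finType) (F S : {set T}) (ws1 ws2 : seq (weighing T)) :
  consistent F (ws1 ++ ws2) S <-> consistent F ws1 S /\ consistent F ws2 S.
Proof.
split=> [cons | [cons1 cons2] w].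
  by split=> w ws_w; apply: cons; rewrite mem_cat ws_w ?orbT.
by rewrite mem_cat => /orP[/cons1 | /cons2].
Qed.

Section Comparisons.

Variables (T I : finType) (X : I -> {set T}) (p : seq (I * I)).

Lemma valid_comparisons m :
    0 < m -> (forall i, #|X i| = m) ->
    (forall i j, i != j -> [disjoint X i & X j]) ->
    (forall e, e \in p -> e.1 != e.2) ->
  forall w, w \in comparisons X p -> valid_weighing w.
Proof.
move=> m_gt0 cardX disX neq_p w /mapP[[i j] /neq_p neq_ij ->].
by split; rewrite /= ?cardX ?disX.
Qed.

Lemma consistent_comparisons (F S : {set T}) :
    (forall i j, #|F :&: X i| = #|F :&: X j|) ->
    (forall i j, #|S :&: X i| = #|S :&: X j|) ->
  consistent F (comparisons X p) S.
Proof.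
move=> eqF eqS w /mapP[[i j] _ ->].
by rewrite (iffRL (weigh_balancedP _ _ _) (eqS i j))
           (iffRL (weigh_balancedP _ _ _) (eqF i j)).
Qed.

(** Equality of counts propagates along the edges of the comparison graph, so
    connectedness extends it to all pairs. *)
Lemma comparisons_balance (F S : {set T}) :
    (forall i j, connect [rel x y | ((x, y) \in p) || ((y, x) \in p)] i j) ->
    (forall i j, #|F :&: X i| = #|F :&: X j|) ->
    consistent F (comparisons X p) S ->
  forall i j, #|S :&: X i| = #|S :&: X j|.
Proof.
move=> conn_p eqF cons i j.
have edge a b : (a, b) \in p -> #|S :&: X a| = #|S :&: X b|.
  move=> p_ab; apply/weigh_balancedP.
  by rewrite cons ?(map_f (fun e => (X e.1, X e.2)) p_ab) //; apply/weigh_balancedP.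
have /connectP[q path_q ->] := conn_p i j.
elim: q i path_q => //= y q IHq x /andP[/orP xy /IHq <-].
by case: xy => /edge.
Qed.

End Comparisons.

(** * Sets of coins and pairwise disjoint families *)

Lemma choose_in_each (T I : finType) (Y : I -> {set T}) :
  (forall i, 0 < #|Y i|) -> exists h : I -> T, forall i, h i \in Y i.
Proof.
move=> Y_gt0; apply: (fin_all_exists (P := fun i x => x \in Y i)) => i.
exact/card_gt0P.
Qed.

Section DisjointFamily.

Variables (T I : finType) (G : I -> {set T}).
Hypothesis disG : forall i j, i != j -> [disjoint G i & G j].

Lemma transversal_image (h : I -> T) :
    (forall i, h i \in G i) ->
  #|h @: setT| = #|I| /\ one_in_each (h @: setT) G.
Proof.
move=> hG.
have hinj i j : h i \in G j -> i = j.
  move=> hij; apply: contraTeq hij => /disG dis.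
  by rewrite (disjointFr dis (hG i)).
split.
  rewrite card_imset ?cardsT // => i j eq_h.
  by apply: hinj; rewrite eq_h hG.
move=> j; apply/eqP/cards1P; exists (h j); apply/setP=> x; rewrite !inE.
apply/andP/eqP=> [[/imsetP[i _ ->] /hinj ->] // | ->].
by rewrite imset_f ?hG.
Qed.

(** Choosing a point of [S] in each member yields a transversal inside [S]. *)
Lemma leq_card_meets_disjoint (S : {set T}) :
  (forall i, 0 < #|S :&: G i|) -> #|I| <= #|S|.
Proof.
move=> meetS.
have [h hSG] := choose_in_each meetS.
have [i|<- _] := @transversal_image h; first by case/setIP: (hSG i).
by apply: subset_leq_card; apply/subsetP=> _ /imsetP[i _ ->]; case/setIP: (hSG i).
Qed.

(** Cardinality: one element in each member of the family already accounts for
    all of [S]. *)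
Lemma one_in_each_subset (S : {set T}) :
  #|S| = #|I| -> one_in_each S G -> S \subset \bigcup_i G i.
Proof.
move=> cardS oneS.
have [i|h hSG] := @choose_in_each T I (fun i => S :&: G i); first by rewrite oneS.
have hG i : h i \in G i by case/setIP: (hSG i).
have [card_h _] := transversal_image hG.
suff <- : h @: setT = S.
  by apply/subsetP=> _ /imsetP[i _ ->]; apply/bigcupP; exists i; rewrite ?hG.
apply/eqP; rewrite eqEcard card_h cardS leqnn andbT.
by apply/subsetP=> _ /imsetP[i _ ->]; case/setIP: (hSG i).
Qed.

Lemma one_in_each_disjoint (S Y : {set T}) :
    #|S| = #|I| -> one_in_each S G -> (forall i, [disjoint G i & Y]) ->
  S :&: Y = set0.
Proof.
move=> cardS oneS disGY; apply: disjoint_setI0.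
have disY : [disjoint \bigcup_i G i & Y].
  by rewrite disjoint_sym; apply: bigcup_disjoint => i _; rewrite disjoint_sym.
exact: disjointWl (one_in_each_subset cardS oneS) disY.
Qed.

Lemma transversal_through (i : I) (c : T) :
    (forall j, 0 < #|G j|) -> c \in G i ->
  exists S : {set T}, [/\ #|S| = #|I|, one_in_each S G & c \in S].
Proof.
move=> G_gt0 Gc.
have [h [hG <-]] : exists h : I -> T, (forall j, h j \in G j) /\ h i = c.
  have [h0 h0G] := choose_in_each G_gt0.
  exists [eta h0 with i |-> c]; split=> [j|] /=; last by rewrite eqxx.
  by case: eqP => [->|].
have [card_h one_h] := transversal_image hG.
by exists (h @: setT); rewrite imset_f.
Qed.

End DisjointFamily.

(** * Coins divided into three families of groups *)

Section ThreeFamilies.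

Variables (T I : finType) (A B C : I -> {set T}).
Hypothesis division : divided_into (groups A B C).
Implicit Type S : {set T}.

Let AB i := A i :|: B i.
Let BC i := B i :|: C i.

Lemma disjoint_groups (x y : I + I + I) :
  x != y -> [disjoint groups A B C x & groups A B C y].
Proof. exact: division.2. Qed.

Lemma disjA i j : i != j -> [disjoint A i & A j].
Proof. by move=> ij; apply: (@disjoint_groups (inl (inl i)) (inl (inl j))). Qed.

Lemma disjB i j : i != j -> [disjoint B i & B j].
Proof. by move=> ij; apply: (@disjoint_groups (inl (inr i)) (inl (inr j))). Qed.

Lemma disjC i j : i != j -> [disjoint C i & C j].
Proof. by move=> ij; apply: (@disjoint_groups (inr i) (inr j)). Qed.

Lemma disjAB i j : [disjoint A i & B j].
Proof. exact: (@disjoint_groups (inl (inl i)) (inl (inr j))). Qed.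

Lemma disjAC i j : [disjoint A i & C j].
Proof. exact: (@disjoint_groups (inl (inl i)) (inr j)). Qed.

Lemma disjBC i j : [disjoint B i & C j].
Proof. exact: (@disjoint_groups (inl (inr i)) (inr j)). Qed.

Lemma coinP c :
  [\/ exists i, c \in A i, exists i, c \in B i | exists i, c \in C i].
Proof.
have: c \in [set: T] by [].
rewrite -division.1 => /bigcupP[[[i|i]|i] _ /= Gc].
- by apply: Or31; exists i.
- by apply: Or32; exists i.
- by apply: Or33; exists i.
Qed.

Lemma card_setI_AB S i : #|S :&: AB i| = #|S :&: A i| + #|S :&: B i|.
Proof.
by rewrite setIUr cardsU -setIIr (disjoint_setI0 (disjAB i i)) setI0 cards0 subn0.
Qed.

Lemma card_setI_BC S i : #|S :&: BC i| = #|S :&: B i| + #|S :&: C i|.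
Proof.
by rewrite setIUr cardsU -setIIr (disjoint_setI0 (disjBC i i)) setI0 cards0 subn0.
Qed.

Lemma disjoint_unions_AB i j : i != j -> [disjoint AB i & AB j].
Proof.
move=> ij; rewrite -setI_eq0 setIUl !setIUr !setU_eq0 !setI_eq0.
by rewrite disjA // disjB // disjAB disjoint_sym disjAB.
Qed.

Lemma disjoint_unions_BC i j : i != j -> [disjoint BC i & BC j].
Proof.
move=> ij; rewrite -setI_eq0 setIUl !setIUr !setU_eq0 !setI_eq0.
by rewrite disjB // disjC // disjBC disjoint_sym disjBC.
Qed.

Definition placement (S : {set T}) : Prop :=
  #|S| = #|I| /\ (one_in_each S A \/ one_in_each S B \/ one_in_each S C).

(** With the coins in the [A i], [B i] or [C i], the pair of counts in
    [A i :|: B i] and [B i :|: C i] is [(1, 0)], [(1, 1)] or [(0, 1)]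
    respectively, whatever [i]. *)
Lemma placement_uniform S :
    placement S ->
  (forall i j, #|S :&: AB i| = #|S :&: AB j|) /\
  (forall i j, #|S :&: BC i| = #|S :&: BC j|).
Proof.
have [disjBA disjCA disjCB] :
    [/\ forall i j, [disjoint B i & A j], forall i j, [disjoint C i & A j]
      & forall i j, [disjoint C i & B j]].
  by split=> i j; rewrite disjoint_sym (disjAB, disjAC, disjBC).
have zero (G : I -> {set T}) (Y : {set T}) : (forall i j, i != j -> [disjoint G i & G j]) ->
    #|S| = #|I| -> one_in_each S G -> (forall i, [disjoint G i & Y]) ->
    #|S :&: Y| = 0.
  by move=> disG cardS oneS disGY; rewrite (one_in_each_disjoint disG) ?cards0.
case=> cardS [oneS|[oneS|oneS]].
- have [zB zC] : (forall i, #|S :&: B i| = 0) /\ (forall i, #|S :&: C i| = 0).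
    by split=> i; apply: zero disjA cardS oneS _ => j; rewrite (disjAB, disjAC).
  by split=> i j; rewrite !(card_setI_AB, card_setI_BC) ?oneS ?zB ?zC.
- have [zA zC] : (forall i, #|S :&: A i| = 0) /\ (forall i, #|S :&: C i| = 0).
    by split=> i; apply: zero disjB cardS oneS _ => j; rewrite (disjBA, disjBC).
  by split=> i j; rewrite !(card_setI_AB, card_setI_BC) ?oneS ?zA ?zC.
- have [zA zB] : (forall i, #|S :&: A i| = 0) /\ (forall i, #|S :&: B i| = 0).
    by split=> i; apply: zero disjC cardS oneS _ => j; rewrite (disjCA, disjCB).
  by split=> i j; rewrite !(card_setI_AB, card_setI_BC) ?oneS ?zA ?zB.
Qed.

(** One coin of [S] lies in some [A i :|: B i] or in some [B i :|: C i]; by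
    equality of counts [S] then meets all sets of that disjoint family. *)
Lemma leq_card_uniform S :
    0 < #|S| ->
    (forall i j, #|S :&: AB i| = #|S :&: AB j|) ->
    (forall i j, #|S :&: BC i| = #|S :&: BC j|) ->
  #|I| <= #|S|.
Proof.
move=> /card_gt0P[c Sc] eqAB eqBC.
have leAB i : c \in AB i -> #|I| <= #|S|.
  move=> ABc; apply: (leq_card_meets_disjoint disjoint_unions_AB) => j.
  by rewrite (eqAB j i); apply/card_gt0P; exists c; rewrite inE Sc.
have leBC i : c \in BC i -> #|I| <= #|S|.
  move=> BCc; apply: (leq_card_meets_disjoint disjoint_unions_BC) => j.
  by rewrite (eqBC j i); apply/card_gt0P; exists c; rewrite inE Sc.
have [[i Ac]|[i Bc]|[i Cc]] := coinP c.
- by apply: (leAB i); rewrite inE Ac.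
- by apply: (leAB i); rewrite inE Bc orbT.
- by apply: (leBC i); rewrite inE Cc orbT.
Qed.

Lemma placement_through c :
    (forall i, [/\ 0 < #|A i|, 0 < #|B i| & 0 < #|C i|]) ->
  exists S : {set T}, placement S /\ c \in S.
Proof.
move=> gt0.
have [[i Gc]|[i Gc]|[i Gc]] := coinP c.
- have [|S [cardS oneS Sc]] := transversal_through disjA _ Gc.
    by move=> j; case: (gt0 j).
  by exists S; split=> //; split=> //; left.
- have [|S [cardS oneS Sc]] := transversal_through disjB _ Gc.
    by move=> j; case: (gt0 j).
  by exists S; split=> //; split=> //; right; left.
- have [|S [cardS oneS Sc]] := transversal_through disjC _ Gc.
    by move=> j; case: (gt0 j).
  by exists S; split=> //; split=> //; right; right.
Qed.

(** A coin outside the [A i] is avoided by every transversal of the [A i], and a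
    coin of some [A i] by every transversal of the [B i]. *)
Lemma placement_avoiding c :
    (forall i, [/\ 0 < #|A i|, 0 < #|B i| & 0 < #|C i|]) ->
  exists S : {set T}, placement S /\ c \notin S.
Proof.
move=> gt0.
have [j|hA hAP] := @choose_in_each T I A; first by case: (gt0 j).
have [j|hB hBP] := @choose_in_each T I B; first by case: (gt0 j).
have [[i Ac]|notA] : (exists i, c \in A i) \/ (forall i, c \notin A i).
  case: (boolP [exists i, c \in A i]) => [/existsP|/existsPn]; by [left|right].
- have [cardS oneS] := transversal_image disjB hBP.
  exists (hB @: setT); split; first by split=> //; right; left.
  by apply/imsetP=> -[j _ eq_c]; rewrite eq_c (disjointFl (disjAB i j)) in Ac.
- have [cardS oneS] := transversal_image disjA hAP.
  exists (hA @: setT); split; first by split=> //; left.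
  by apply/imsetP=> -[j _ eq_c]; have := notA j; rewrite eq_c hAP.
Qed.

End ThreeFamilies.

(** * The strategy *)

Theorem theorem11 (T : finType) (t f d k r : nat)
    (A B C : 'I_f -> {set T}) (F : {set T}) (pAB pBC : seq ('I_f * 'I_f))
    (cardT : #|T| = t)
    (t_gt0 : 0 < t) (f_gt0 : 0 < f) (tf_ge4 : 4 <= t %/ f)
    (d_gt0 : 0 < d) (d_lt_f : d < f)
    (t_eq : t = f * k + r) (k_ge4 : 4 <= k) (r_gt0 : 0 < r) (r_lt_f : r < f)
    (division : divided_into (groups A B C))
    (sizes_lo : forall i : 'I_f, i < r ->
       [/\ #|A i| = k - 2, #|B i| = 1 & #|C i| = 2])
    (sizes_hi : forall i : 'I_f, r <= i ->
       [/\ #|A i| = k - 3, #|B i| = 2 & #|C i| = 1])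
    (cardF : #|F| = f)
    (placeF : one_in_each F A \/ one_in_each F B \/ one_in_each F C)
    (schemeAB : comparison_scheme pAB) (schemeBC : comparison_scheme pBC) :
  let AB := fun i => A i :|: B i in
  let BC := fun i => B i :|: C i in
  let wsAB := comparisons AB pAB in
  let wsBC := comparisons BC pBC in
  [/\ forall i, #|AB i| = k - 1 /\ #|BC i| = 3,
      shows_balance F wsAB AB,
      shows_balance F wsBC BC,
      is_strategy f d F (wsAB ++ wsBC)
    & is_discreet f F (wsAB ++ wsBC)].
Proof.
move=> AB BC wsAB wsBC.
have cardAB i : #|AB i| = k - 1.
  rewrite -[AB i]setTI (card_setI_AB division) !setTI.
  case: (ltnP i r) => [/sizes_lo | /sizes_hi] [-> -> _];
    by case: (k) k_ge4 => [|[|[|k']]] // _; rewrite !subSS !subn0 ?addn1 ?addn2.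
have cardBC i : #|BC i| = 3.
  rewrite -[BC i]setTI (card_setI_BC division) !setTI.
  by case: (ltnP i r) => [/sizes_lo | /sizes_hi] [_ -> ->].
have gt0 i : [/\ 0 < #|A i|, 0 < #|B i| & 0 < #|C i|].
  case: (ltnP i r) => [/sizes_lo | /sizes_hi] [-> -> ->]; split=> //;
    by rewrite subn_gt0; apply: leq_trans k_ge4.
have [_ neqAB connAB] := schemeAB; have [_ neqBC connBC] := schemeBC.
have [eqAB eqBC] : (forall i j, #|F :&: AB i| = #|F :&: AB j|) /\
                   (forall i j, #|F :&: BC i| = #|F :&: BC j|).
  by apply: placement_uniform; rewrite // /placement card_ord.
have place_cons S : placement A B C S -> consistent F (wsAB ++ wsBC) S.
  case/(placement_uniform division) => eqSAB eqSBC.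
  by apply/consistent_cat; split; apply: consistent_comparisons.
split.
- by [].
- by move=> S consS i j; apply/weigh_balancedP; apply: comparisons_balance consS _ _.
- by move=> S consS i j; apply/weigh_balancedP; apply: comparisons_balance consS _ _.
- split=> // [w | [S [cardS /consistent_cat[consAB consBC]]]].
    rewrite mem_cat => /orP[].
      apply: (valid_comparisons _ cardAB (disjoint_unions_AB division)) => //.
      by rewrite subn_gt0; apply: leq_trans k_ge4.
    exact: (valid_comparisons _ cardBC (disjoint_unions_BC division)).
  have: #|'I_f| <= #|S|.
    apply: (leq_card_uniform division); first by rewrite cardS.
      exact: comparisons_balance consAB.
    exact: comparisons_balance consBC.
  by rewrite card_ord cardS leqNgt d_lt_f.
- move=> c; split.
    have [S [placeS Sc]] := placement_through division c gt0.
    by exists S; split=> //; [rewrite placeS.1 card_ord | apply: place_cons].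
  have [S [placeS Sc]] := placement_avoiding division c gt0.
  by exists S; split=> //; [rewrite placeS.1 card_ord | apply: place_cons].
Qed.
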